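(* Let $d\ge2$ and let $\mathcal{G}(t)$ be a time-varying directed graph that is uniformly quasi-strongly connected. Consider the system on $(\mathbb{S}^{d-1})^n$ $$\dot{x}_i = (I - x_ix_i^T)\sum_{j \in \mathcal{N}_i(t)}f_{ij}(\|x_j - x_i\|)(x_j - x_i),\qquad i=1,\dots,n.$$ Then for any closed ball $B$ on $\mathbb{S}^{d-1}$ contained in an open hemisphere, the consensus set $\mathcal{A}=\{x\in(\mathbb{S}^{d-1})^n : x_i=x_j\text{ for all }i,j\}$ is globally uniformly asymptotically stable relative to $B^n$ under this system.
   Context: Notation: $\mathbb{S}^{d-1}=\{y\in\mathbb{R}^d:\|y\|=1\}$ (Euclidean norm), $x=[x_1^T,\dots,x_n^T]^T$. An open hemisphere is a set $\{w\in\mathbb{S}^{d-1}:w^Tv>0\}$ with $v\in\mathbb{S}^{d-1}$. A closed ball on $\mathbb{S}^{d-1}$ is a set $\{y\in\mathbb{S}^{d-1}:\|y-c\|\le r\}$ with $c\in\mathbb{S}^{d-1}$, $r>0$. Weights: each $f_{ij}:\mathbb{R}\to\mathbb{R}$ is Lipschitz and attains positive values for positive arguments. Time-varying graphs: the node set is $\mathcal{V}=\{1,\dots,n\}$. Each neighborhood $\mathcal{N}_i(t)\subset\mathcal{V}$ is a piecewise constant, right-continuous set-valued function of $t\in\mathbb{R}$; there is $\tau_D>0$ such that for every $i$ consecutive discontinuity times $\tau_{ik}$ of $\mathcal{N}_i$ satisfy $\inf_k(\tau_{i(k+1)}-\tau_{ik})>\tau_D$. The graph is $\mathcal{G}(t)=(\mathcal{V},\mathcal{E}(t))$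 with $(i,j)\in\mathcal{E}(t)$ iff $j\in\mathcal{N}_i(t)$. Node $i$ is connected to $j$ if there is a directed path from $i$ to $j$. A directed graph is quasi-strongly connected if there is at least one node to which all other nodes are connected. The union graph is $\mathcal{G}([t_1,t_2))=(\mathcal{V},\bigcup_{t\in[t_1,t_2)}\mathcal{E}(t))$. $\mathcal{G}(t)$ is uniformly quasi-strongly connected if there is $T>0$ such that $\mathcal{G}([t,t+T))$ is quasi-strongly connected for all $t$. Solutions are continuous and satisfy the differential equation except at switching times of the graph; $x(0)=x_0$. A set $\mathcal{S}$ is forward invariant if an initial state in $\mathcal{S}$ implies that the state is in $\mathcal{S}$ for all future times. With $\mathrm{dist}(v,\mathcal{A})=\inf_{w\in\mathcal{A}}\|w-v\|$, the set $\mathcal{A}$ is globally uniformly asymptotically stable relative to a forward invariant compact set $\mathcal{S}\subset(\mathbb{S}^{d-1})^n$ if (1) for every $\epsilon>0$ there is $T(\epsilon)>0$ such that $x_0\in\mathcal{S}$ implies $\mathrm{dist}(x(T(\epsilon)),\mathcal{A})\le\epsilon$; and (2) for every $\epsilon>0$ there is $\delta(\epsilon)>0$ such that $x_0\in\mathcal{S}$ and $\mathrm{dist}(x_0,\mathcal{A})\le\delta$ imply $\mathrm{dist}(x(t),\mathcal{A})\le\epsilon$ for all $t\ge0$. *)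

(* Defs.v *)
From HB Require Import structures.
From mathcomp Require Import all_boot all_order all_algebra.
From mathcomp Require Import all_classical all_reals all_analysis.

Set Implicit Arguments.
Unset Strict Implicit.
Unset Printing Implicit Defensive.

Import Order.TTheory GRing.Theory Num.Theory.
Import numFieldNormedType.Exports.

Local Open Scope classical_set_scope.
Local Open Scope ring_scope.

(* The state (x_1, ..., x_n) is the d x n matrix with columns
   x_i; topology and derivatives are the library's entrywise ones. *)

(* The library's norm on matrices is the sup norm.  On a d x n matrix [enorm]
   is the Euclidean norm of the stacked vector [x_1^T, ..., x_n^T]^T. *)
Definition enorm (R : realType) (m n : nat) (A : 'M[R]_(m, n)) : R :=
  Num.sqrt (\sum_i \sum_j A i j ^+ 2).

Definition sphere (R : realType) (d : nat) : set 'cV[R]_d :=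
  [set y | enorm y = 1].

Definition open_hemisphere (R : realType) (d : nat) (v : 'cV[R]_d) :
  set 'cV[R]_d :=
  [set w | sphere w /\ 0 < (w^T *m v) ord0 ord0].

Definition sphere_ball (R : realType) (d : nat) (c : 'cV[R]_d) (r : R) :
  set 'cV[R]_d :=
  [set y | sphere y /\ enorm (y - c) <= r].

Definition cartesian_power (R : realType) (d n : nat) (B : set 'cV[R]_d) :
  set 'M[R]_(d, n) :=
  [set X | forall i, B (col i X)].

Definition consensus (R : realType) (d n : nat) : set 'M[R]_(d, n) :=
  [set X | cartesian_power (@sphere R d) X /\ forall i j, col i X = col j X].

Definition dist (R : realType) (m n : nat) (v : 'M[R]_(m, n))
  (A : set 'M[R]_(m, n)) : R :=
  inf [set enorm (w - v) | w in A].

Definition switching_times (R : realType) (T : Type) (N : R -> T) : set R :=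
  [set t | ~ \forall s \near t, N s = N t].

Definition consecutive (R : realType) (D : set R) (s t : R) : Prop :=
  [/\ D s, D t, s < t & forall u, s < u < t -> ~ D u].

(* Off its switching times a function is locally constant, hence constant on
   each interval free of switching times. *)
Definition piecewise_constant (R : realType) (T : Type) (N : R -> T) : Prop :=
  forall a b : R, finite_set (switching_times N `&` `[a, b]).

Definition right_continuous (R : realType) (T : Type) (N : R -> T) : Prop :=
  forall t : R, \forall s \near t^'+, N s = N t.

(* The infimum is taken in the extended reals: it is +oo when a neighborhood
   has fewer than two switching times. *)
Definition dwell_time (R : realType) (n : nat)
  (N : 'I_n -> R -> {set 'I_n}) : Prop :=
  exists2 tauD : R, 0 < tauD & forall i,
    (tauD%:E < ereal_inf [set (p.2 - p.1)%:E | p in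
       [set p : R * R | consecutive (switching_times (N i)) p.1 p.2]])%E.

Definition neighborhoods (R : realType) (n : nat)
  (N : 'I_n -> R -> {set 'I_n}) : Prop :=
  [/\ forall i, piecewise_constant (N i),
      forall i, right_continuous (N i)
    & dwell_time N].

Definition quasi_strongly_connected (n : nat) (e : rel 'I_n) : Prop :=
  exists r, forall i, connect e i r.

Definition union_graph (R : realType) (n : nat) (N : 'I_n -> R -> {set 'I_n})
  (t1 t2 : R) : rel 'I_n :=
  [rel i j | `[< exists t, t1 <= t < t2 /\ j \in N i t >]].

Definition uniformly_quasi_strongly_connected (R : realType) (n : nat)
  (N : 'I_n -> R -> {set 'I_n}) : Prop :=
  exists2 T : R, 0 < T &
    forall t, quasi_strongly_connected (union_graph N t (t + T)).

Definition weights (R : realType) (n : nat) (f : 'I_n -> 'I_n -> R -> R) :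
  Prop :=
  forall i j, [lipschitz f i j y | y in [set: R]] /\
              (forall y, 0 < y -> 0 < f i j y).

Definition vector_field (R : realType) (d n : nat)
  (f : 'I_n -> 'I_n -> R -> R) (N : 'I_n -> R -> {set 'I_n})
  (t : R) (X : 'M[R]_(d, n)) (i : 'I_n) : 'cV[R]_d :=
  let x k := col k X in
  (1%:M - x i *m (x i)^T) *m
    \sum_(j in N i t) f i j (enorm (x j - x i)) *: (x j - x i).

(* Trajectories on the time interval [0, +oo[; the values at negative times
   are irrelevant (so the equation at time 0, if 0 is not a switching time, is
   the one-sided consequence of continuity). *)
Definition solution (R : realType) (d n : nat)
  (f : 'I_n -> 'I_n -> R -> R) (N : 'I_n -> R -> {set 'I_n})
  (X : R -> 'M[R]_(d, n)) : Prop :=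
  [/\ forall t, 0 <= t -> cartesian_power (@sphere R d) (X t),
      {within `[0, +oo[, continuous X}
    & forall t, 0 < t -> (forall i, ~ switching_times (N i) t) ->
        forall i, is_derive t (1 : R) (fun s => col i (X s))
                    (vector_field f N t (X t) i)].

Definition forward_invariant (R : realType) (d n : nat)
  (traj : set (R -> 'M[R]_(d, n))) (S : set 'M[R]_(d, n)) : Prop :=
  forall X, traj X -> S (X 0) -> forall t, 0 <= t -> S (X t).

(* The first three conjuncts are the conditions on S under which the notion
   is defined. *)
Definition guas_relative (R : realType) (d n : nat)
  (traj : set (R -> 'M[R]_(d, n))) (A S : set 'M[R]_(d, n)) : Prop :=
  [/\ S `<=` cartesian_power (@sphere R d),
      compact S,
      forward_invariant traj S,
      forall eps : R, 0 < eps -> exists2 T : R, 0 < T &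
        forall X, traj X -> S (X 0) -> dist (X T) A <= eps
    & forall eps : R, 0 < eps -> exists2 delta : R, 0 < delta &
        forall X, traj X -> S (X 0) -> dist (X 0) A <= delta ->
        forall t, 0 <= t -> dist (X t) A <= eps].

(* Main.v *)
Require Import Defs.
From mathcomp Require Import all_boot all_order all_algebra.
From mathcomp Require Import all_classical all_reals all_analysis.
From mathcomp Require Import ring lra.

Set Implicit Arguments.
Unset Strict Implicit.
Unset Printing Implicit Defensive.

Import Order.TTheory GRing.Theory Num.Theory.
Import numFieldNormedType.Exports.

Local Open Scope classical_set_scope.
Local Open Scope ring_scope.

(** The ball [sphere_ball c r] is the cap [{y | cdot c y >= kappa}] of the sphere,
with [kappa = 1 - r^2/2]; since it lies in an open hemisphere and [d >= 2],
[kappa] is positive ([sphere_ball_in_hemisphere]).  Write [y_i = cdot c x_i] for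
the height of agent [i].  The tangential projection in the dynamics gives
[y_i' = sum_j f_ij (y_j - (x_i . x_j) y_i)], so the lowest height cannot
decrease while it is nonnegative: the cap is forward invariant
([cap_invariant]).

Inside the cap, the gnomonic projection [z_i = x_i / y_i] turns the system into
a consensus system in a hyperplane,
[z_i' = sum_j a_ij (z_j - z_i)] with [a_ij = f_ij (|x_j - x_i|) y_j / y_i],
and every coordinate of [z] separately satisfies this scalar equation
([projective_scalar_consensus]).  The gains [a_ij] are nonnegative and bounded.
They may vanish at consensus, but they are bounded below whenever [z_i] and
[z_j] differ by a fixed amount in the coordinate at hand.  The projection is
bi-Lipschitz on the cap ([gnomonic_nonexpansive], [gnomonic_lipschitz]), so the
claim reduces to a statement about scalar consensus that is uniform in the
gains.

For scalar consensus the range of the states never grows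
([scalar_consensus_bounds]), which gives stability.  For attractivity, suppose
that the states lie between [m] and [M], with [M - m >= e].  Call a node low if
its state is at most [M - delta] and high if it is at least [m + delta]; for
[delta = e/2] every node is one of the two.  Low nodes stay low over a bounded time, for a smaller [delta]
([consensus_persist]).  In each connectivity window the root is low, say; if
some node is not low, then an edge of the window goes from a node that is not
low to a low one.  The dwell time keeps that edge for a fixed time
([dwell_interval]), which pulls its source down ([consensus_pull]).  So
the number of low nodes plus the number of high nodes grows in every window
until all nodes are low or all nodes are high ([low_high_contract]), after at
most [n] windows.  The range then has shrunk by an amount that depends only on
[e] and the bounds on the gains and the graph ([range_decrease]); iterating, it falls below [e] within a time independent
of the solution ([scalar_consensus_attractive]).

Both invariance statements come from one barrier principle
([quasipositive_barrier]), proved by a Gronwall estimate on the sum of the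
squared positive parts. *)

(** * Differential inequalities *)

Lemma is_derive_mulf (R : realType) (f g : R -> R) (x df dg : R) :
  is_derive x 1 f df -> is_derive x 1 g dg ->
  is_derive x 1 (fun s => f s * g s) (f x * dg + g x * df).
Proof. by move=> Df Dg; exact: is_deriveM. Qed.

Lemma is_derive_sumf (R : realType) (n : nat) (h : 'I_n -> R -> R) (x : R)
    (dh : 'I_n -> R) :
  (forall i, is_derive x 1 (h i) (dh i)) ->
  is_derive x 1 (fun s => \sum_i h i s) (\sum_i dh i).
Proof.
move=> Dh; have := is_derive_sum (h := h) (dh := dh) Dh.
by congr is_derive; apply/funext => s; rewrite fct_sumE.
Qed.

Lemma cvg_sumf (R : realType) (T : Type) (F : set_system T)
    {FF : Filter F} (n : nat)
    (h : 'I_n -> T -> R) (l : 'I_n -> R) :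
  (forall i, h i @ F --> l i) ->
  (fun s => \sum_i h i s) @ F --> \sum_i l i.
Proof.
move=> hl; rewrite (_ : (fun s => _) = \sum_i h i); last first.
  by apply/funext => s; rewrite fct_sumE.
by elim/big_ind2 : _ => // [|*]; [exact: cvg_cst|exact: cvgD].
Qed.

Lemma continuous_itvcc_sub (R : realType) (f : R -> R) (a b a' b' : R) :
  a <= a' -> b' <= b -> {within `[a, b], continuous f} ->
  {within `[a', b'], continuous f}.
Proof.
move=> aa' bb'; apply: continuous_subspaceW => x /=.
by rewrite !in_itv /= => /andP[a'x xb']; rewrite (le_trans aa') ?(le_trans xb').
Qed.

Lemma continuous_itvcy_sub (R : realType) (f : R -> R) (a b : R) :
  0 <= a -> {within `[0, +oo[, continuous f} -> {within `[a, b], continuous f}.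
Proof.
move=> a0; apply: continuous_subspaceW => x /=.
by rewrite !in_itv /= andbT => /andP[ax _]; exact: le_trans ax.
Qed.

(** The derivative is only controlled off a finite set: solutions need not be
differentiable at the switching times. *)
Lemma nonincreasing_off_finite (R : realType) (E : seq R) (f : R -> R) (a b : R) :
  a <= b -> {within `[a, b], continuous f} ->
  (forall t, a < t < b -> t \notin E ->
     exists2 df : R, is_derive t 1 f df & df <= 0) ->
  f b <= f a.
Proof.
elim: E a b => [|e E IHE] a b ab cf dfab.
  apply: (@ler0_derive1_le_cc _ f a b) => //=.
  - move=> x; rewrite in_itv /= => xab.
    by have [df []] := dfab x xab isT.
  - move=> x; rewrite in_itv /= => xab.
    by have [df [_ ddf] df0] := dfab x xab isT; rewrite derive1E ddf.
  - by rewrite in_itv /= lexx ab.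
  - by rewrite in_itv /= lexx ab.
have [/andP[ae eb]|eab] := boolP (a < e < b); last first.
  apply: IHE => // t tab tE; apply: dfab => //.
  by rewrite inE negb_or tE andbT; apply: contraNneq eab => <-.
apply: (@le_trans _ _ (f e)); apply: IHE; rewrite ?(ltW ae) ?(ltW eb)//.
- exact: continuous_itvcc_sub (ltW ae) (lexx _) cf.
- move=> t /andP[et tb] tE; apply: dfab; first by rewrite (lt_trans ae).
  by rewrite inE negb_or tE andbT gt_eqF.
- exact: continuous_itvcc_sub (lexx _) (ltW eb) cf.
- move=> t /andP[at_ te] tE; apply: dfab; first by rewrite at_ (lt_trans te).
  by rewrite inE negb_or tE andbT lt_eqF.
Qed.

Lemma is_derive_pospart_sqr (R : realType) (x : R) :
  is_derive x 1 (fun z : R => Num.max z 0 ^+ 2) (2 * Num.max x 0).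
Proof.
case: (ltgtP x 0) => [x0|x0|->].
- rewrite mulr0; apply: (@near_eq_is_derive _ _ _ (cst (0 : R))).
  near=> z; have z0 : z < 0 by near: z; exact: lt_nbhsl.
  by rewrite /cst (max_r (ltW z0)) expr0n.
- apply: (@near_eq_is_derive _ _ _ (fun z : R => z * z)).
    near=> z; have z0 : 0 < z by near: z; exact: lt_nbhsr.
    by rewrite (max_l (ltW z0)) expr2.
  apply: (is_derive_eq (is_derive_mulf (is_derive_id _ _) (is_derive_id _ _))).
  by rewrite mulr1 -mulr2n mulr_natl.
rewrite mulr0.
have h0 : (fun h : R => h^-1 *: (((fun z : R => Num.max z 0 ^+ 2) \o shift 0) (h *: 1)
     - Num.max 0 0 ^+ 2)) @ 0^' --> (0 : R).
  apply/cvgrPdist_le => /= e e0; near=> h.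
  rewrite maxxx expr0n /= subr0 sub0r normrN [h%:A]mulr1 addr0 [_ *: _]mulrC.
  have hn0 : h != 0 by near: h; exact: nbhs_dnbhs_neq.
  have he : `|h| <= e by near: h; apply: dnbhs0_le.
  case: (ltP 0 h) => _.
    by rewrite expr2 mulfK.
  by rewrite expr0n /= mul0r normr0 ltW.
by apply: DeriveDef; [apply/cvg_ex; exists 0|apply/cvg_lim].
Unshelve. all: by end_near. Qed.

(** If each [g i], where it is positive, grows at most at a rate proportional to
the sum of the positive parts of all the [g j], then they all remain
nonpositive once they are. *)
Lemma quasipositive_barrier (R : realType) (n : nat) (E : seq R)
    (g : 'I_n -> R -> R) (C a b : R) :
  0 <= C -> a <= b -> (forall i, {within `[a, b], continuous (g i)}) ->
  (forall t, a < t < b -> t \notin E -> forall i,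
     exists2 dg : R, is_derive t 1 (g i) dg &
       (0 < g i t -> dg <= C * \sum_j Num.max (g j t) 0)) ->
  (forall i, g i a <= 0) -> forall i, g i b <= 0.
Proof.
move=> C0 ab cg dg ga0.
pose p i t : R := Num.max (g i t) 0.
have p0 i t : 0 <= p i t by rewrite /p le_max lexx orbT.
pose V t := \sum_i p i t ^+ 2.
pose K := 2 * (C * n%:R).
(* Gronwall: V' <= K * V and V a = 0. *)
suff : expR (- K * b) * V b <= expR (- K * a) * V a.
  have -> : V a = 0 by apply: big1 => i _; rewrite /p (max_r (ga0 i)) expr0n.
  rewrite mulr0 pmulr_rle0 ?expR_gt0// => Vb i.
  rewrite leNgt; apply/negP => gib.
  suff : 0 < V b by rewrite ltNge Vb.
  rewrite /V (bigD1 i)//= ltr_pwDl ?sumr_ge0// => [|j _]; last exact: sqr_ge0.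
  by rewrite exprn_gt0// /p (max_l (ltW gib)).
have De (t : R) : is_derive t 1 (fun t => expR (- K * t)) (expR (- K * t) * - K).
  have Dl : is_derive t 1 (fun t => - K * t) (- K).
    apply: (is_derive_eq (is_derive_mulf (is_derive_cst _ _ _) (is_derive_id _ _))).
    by rewrite mulr1 mulr0 addr0.
  exact: is_derive1_comp.
have cV : {within `[a, b], continuous (fun t => expR (- K * t) * V t)}.
  move=> x; apply: cvgM.
    apply: continuous_subspaceT => {}x.
    by apply: differentiable_continuous; apply/derivable1_diffP; case: (De x).
  apply: (@cvg_sumf R _ (nbhs (x : subspace `[a, b])) _ n
    (fun i t => p i t ^+ 2)) => i.
  apply: (@continuous_comp (subspace `[a, b]) R R (g i)
    (fun z => Num.max z 0 ^+ 2)); first exact: cg.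
  apply: differentiable_continuous; apply/derivable1_diffP.
  by case: (is_derive_pospart_sqr (g i x)).
apply: (nonincreasing_off_finite (E := E) ab cV) => t tab tE.
have /choice[dG DG] : forall i, exists d : R, is_derive t 1 (g i) d /\
    (0 < g i t -> d <= C * \sum_j p j t).
  by move=> i; have [d Dd d0] := dg t tab tE i; exists d.
have DV : is_derive t 1 V (\sum_i 2 * p i t * dG i).
  apply: is_derive_sumf => i; have [Di _] := DG i.
  exact: (is_derive1_comp (f := fun z => Num.max z 0 ^+ 2)
    (is_derive_pospart_sqr (g i t)) Di).
exists (expR (- K * t) * (\sum_i 2 * p i t * dG i) + V t * (expR (- K * t) * - K)).
  exact: is_derive_mulf.
rewrite mulrCA -mulrDr pmulr_rle0 ?expR_gt0// mulrN subr_le0.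
apply: (@le_trans _ _ (\sum_i 2 * p i t * (C * \sum_j p j t))).
  apply: ler_sum => i _; have [_ dGi] := DG i.
  have [gi0|gi0] := ltP 0 (g i t).
    by rewrite ler_wpM2l ?mulr_ge0// dGi.
  by rewrite /p (max_r gi0) mulr0 !mul0r.
rewrite -mulr_suml -mulr_sumr; set S := \sum_j p j t.
have -> : 2 * S * (C * S) = 2 * C * (S * S) by ring.
have -> : V t * K = 2 * C * (n%:R * V t) by rewrite /K; ring.
rewrite ler_wpM2l ?mulr_ge0// mulr_suml.
apply: (@le_trans _ _ (\sum_i \sum_j (p i t ^+ 2 + p j t ^+ 2) / 2)).
  apply: ler_sum => i _; rewrite mulr_sumr; apply: ler_sum => j _.
  by have := sqr_ge0 (p i t - p j t); nra.
under eq_bigr do rewrite -mulr_suml big_split /= sumr_const card_ord.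
rewrite -mulr_suml big_split /= sumr_const card_ord sumrMnl -/(V t).
by rewrite -mulr2n -[_ *+ 2]mulr_natr mulfK ?pnatr_eq0// mulr_natl.
Qed.

(** * Switching graphs *)

Lemma constant_between_switches (R : realType) (T : Type) (N : R -> T)
    (a b : R) :
  Defs.right_continuous N -> (forall t, a < t < b -> ~ switching_times N t) ->
  forall t, a <= t < b -> N t = N a.
Proof.
move=> rcN noS.
have inner s t : a < s -> s <= t -> t < b -> N t = N s.
  move=> as_ st tb.
  (* The indicator of [N u <> N s] is locally constant, so its derivative is 0. *)
  pose g u : R := (`[< N u <> N s >])%:R.
  have Dg u : s <= u <= t -> is_derive u 1 g 0.
    move=> /andP[su ut].
    have /contrapT Nu : ~ ~ \forall v \near u, N v = N u.
      by apply: noS; rewrite (lt_le_trans as_) ?(le_lt_trans ut).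
    apply: (@near_eq_is_derive _ _ _ (cst (g u))).
    by apply: filterS Nu => v Nvu; rewrite /g Nvu.
  have : g t <= g s.
    apply: (nonincreasing_off_finite (E := [::]) st) => [|u /andP[su ut] _].
      apply: derivable_within_continuous => u; rewrite in_itv /= => uI.
      by have [] := Dg u uI.
    by exists 0 => //; apply: Dg; rewrite !ltW.
  rewrite /g; case: asboolP => [_|/contrapT //].
  by case: asboolP => // _; rewrite ler10.
move=> t /andP[]; rewrite le_eqVlt => /predU1P[<- //|at_] tb.
have [s [as_ [st Nsa]]] :=
  filter_ex (filterI (nbhs_right_gt a) (filterI (nbhs_right_lt at_) (rcN a))).
by rewrite -Nsa; apply: inner => //; exact: ltW.
Qed.

Lemma seq_extremum (T : eqType) (le : rel T) (s : seq T) :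
  total le -> transitive le -> s != [::] ->
  exists2 m, m \in s & forall x, x \in s -> le m x.
Proof.
move=> letot letr; elim: s => // x [|y s] IH _.
  exists x; first exact: mem_head.
  by move=> z /[!inE] /eqP ->; have := letot x x; rewrite orbb.
have [m ms mle] := IH isT.
have [xm|mx] := orP (letot x m).
  exists x; first exact: mem_head.
  move=> z; rewrite inE => /predU1P[->|/mle]; last exact: letr.
  by have := letot x x; rewrite orbb.
exists m; first by rewrite inE ms orbT.
by move=> z; rewrite inE => /predU1P[->//|/mle].
Qed.

(** Every time lies in (the closure of) an interval of length [h] on which the
value taken at that time is maintained.  The interval starts at [t] if there is
no switch soon after [t]; otherwise the dwell time excludes a switch shortly
before [t], and the interval starts at [t - h]. *)
Lemma dwell_interval (R : realType) (T : Type) (N : R -> T) (tauD h : R) :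
  piecewise_constant N -> Defs.right_continuous N ->
  (forall s t, consecutive (switching_times N) s t -> tauD < t - s) ->
  0 < h -> 2 * h <= tauD ->
  forall t, exists2 s, t - h <= s <= t & forall u, s <= u < s + h -> N u = N t.
Proof.
move=> pcN rcN dwN h0 htau t.
have /finite_seqP[E EN] := pcN (t - h) (t + h).
have inE_ u : t - h <= u <= t + h -> switching_times N u -> u \in E.
  move=> uI Su; suff : [set` E] u by [].
  by rewrite -EN; split => //=; rewrite in_itv.
have Esw u : u \in E -> switching_times N u.
  by move=> uE; have : [set` E] u by []; rewrite -EN => -[].
pose after := [seq u <- E | (t < u)%R].
pose before := [seq u <- E | (u <= t)%R].
have [a0|an0] := eqVneq after [::].
  exists t; first by rewrite lexx gerBl ltW.
  apply: constant_between_switches => // u /andP[tu uth] Su.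
  suff : u \in after by rewrite a0.
  rewrite mem_filter tu inE_//; apply/andP; split; lra.
have [s1 s1a s1min] := seq_extremum (@le_total _ _) le_trans an0.
move: s1a; rewrite mem_filter => /andP[ts1 s1E].
have s1h : s1 <= t + h.
  by have : [set` E] s1 by []; rewrite -EN => -[_ /=]; rewrite in_itv => /andP[].
have nob u : t - h <= u <= t -> ~ switching_times N u.
  move=> /andP[hu ut] Su.
  have bn0 : before != [::].
    have : u \in before by rewrite mem_filter ut inE_// hu; lra.
    by case: before.
  have ge_tot : total (fun x y : R => y <= x) by move=> x y; exact: le_total.
  have ge_tr : transitive (fun x y : R => y <= x).
    by move=> x y z yx zy; exact: le_trans zy yx.
  have [s0 s0b s0max] := seq_extremum ge_tot ge_tr bn0.
  move: s0b; rewrite mem_filter => /andP[s0t s0E].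
  have us0 : u <= s0 by apply: s0max; rewrite mem_filter ut inE_// hu; lra.
  suff : tauD < s1 - s0 by lra.
  apply: dwN; split; [exact: Esw|exact: Esw|exact: le_lt_trans ts1|].
  move=> z /andP[s0z zs1] Sz.
  have zE : z \in E by apply: inE_ => //; apply/andP; split; lra.
  have [tz|zt] := ltP t z.
    by have := s1min z; rewrite mem_filter tz zE leNgt zs1 => /(_ isT).
  by have := s0max z; rewrite mem_filter zt zE leNgt s0z => /(_ isT).
exists (t - h); first by rewrite lexx gerBl ltW.
have cst u : t - h <= u < s1 -> N u = N (t - h).
  apply: constant_between_switches => // z /andP[hz zs1] Sz.
  have [tz|zt] := ltP t z; last by apply: (nob z) => //; rewrite zt ltW.
  have := s1min z; rewrite mem_filter tz inE_ ?leNgt ?zs1 //; first by move/(_ isT).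
  by apply/andP; split; lra.
move=> u /andP[hu ut]; rewrite cst ?[RHS]cst //.
  by rewrite ts1 gerBl ltW.
by rewrite hu; lra.
Qed.

Lemma dwell_time_gap (R : realType) (n : nat) (N : 'I_n -> R -> {set 'I_n}) :
  dwell_time N -> exists2 tauD : R, 0 < tauD &
    forall i s t, consecutive (switching_times (N i)) s t -> tauD < t - s.
Proof.
move=> [tauD tau0 dwN]; exists tauD => // i s t st.
rewrite -lte_fin; apply: (lt_le_trans (dwN i)).
by apply: ereal_inf_lbound; exists (s, t).
Qed.

Lemma switching_times_seq (R : realType) (n : nat) (N : 'I_n -> R -> {set 'I_n})
    (a b : R) :
  (forall i, piecewise_constant (N i)) -> exists E : seq R,
    forall t, a < t < b -> t \notin E -> forall i, ~ switching_times (N i) t.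
Proof.
move=> pcN.
have /choice[E EN] : forall i, exists E : seq R,
    switching_times (N i) `&` `[a, b] = [set` E].
  by move=> i; have /finite_seqP[E EN] := pcN i a b; exists E.
exists (flatten [seq E i | i <- enum 'I_n]) => t /andP[at_ tb] tE i Si.
apply/negP: tE; rewrite negbK; apply/flattenP.
exists (E i); first by apply: map_f; rewrite mem_enum.
suff : [set` E i] t by [].
by rewrite -EN; split => //=; rewrite in_itv /= !ltW.
Qed.

Lemma connect_crossing (T : finType) (e : rel T) (S : {set T}) (x r : T) :
  connect e x r -> x \notin S -> r \in S ->
  exists i j, [/\ i \notin S, j \in S & e i j].
Proof.
move=> /connectP[p]; elim: p x => [x _ -> /negP xS|y p IH x /= /andP[exy py] rE xS rS].
  by move=> /xS.
have [yS|yS] := boolP (y \in S); first by exists x, y.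
exact: IH py rE yS rS.
Qed.

(** * Scalar consensus *)

(** The trajectories of scalar states driven by [w_i' = sum_j a_ij (w_j - w_i)],
the sum running over the neighbors of [i], with gains between [0] and [A] that
are at least [alpha e] whenever the two states involved are at least [e] apart.  The
gains are existentially quantified, so that estimates in terms of [A] and
[alpha] hold uniformly over all such trajectories.  As for [solution], the
equation is required off the switching times only. *)
Definition scalar_consensus (R : realType) (n : nat)
    (N : 'I_n -> R -> {set 'I_n}) (A : R) (alpha : R -> R)
    (w : 'I_n -> R -> R) : Prop :=
  (forall i, {within `[0, +oo[, continuous (w i)}) /\
  exists a : 'I_n -> 'I_n -> R -> R,
    [/\ forall i j t, 0 <= t -> 0 <= a i j t <= A,
        forall i j t e, 0 <= t -> 0 < e -> e <= `|w j t - w i t| ->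
          alpha e <= a i j t
      & forall t, 0 < t -> (forall i, ~ switching_times (N i) t) -> forall i,
          is_derive t 1 (w i) (\sum_(j in N i t) a i j t * (w j t - w i t))].

Section scalar_consensus_theory.
Context (R : realType) (n : nat) (N : 'I_n -> R -> {set 'I_n}).
Context (A : R) (alpha : R -> R).
Implicit Type w : 'I_n -> R -> R.

Let opp w i t := - w i t.

Lemma scalar_consensusN w :
  scalar_consensus N A alpha w -> scalar_consensus N A alpha (opp w).
Proof.
move=> [cw [a [aA aalpha Dw]]]; split=> [i x|]; first exact: cvgN (cw i x).
exists a; split=> // [i j t e t0 e0|t t0 St i].
  by rewrite /opp opprK addrC -normrN opprB; exact: aalpha.
apply: (is_derive_eq (is_deriveN (Dw t t0 St i))).
rewrite -sumrN; apply: eq_bigr => j _.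
by rewrite -mulrN /opp opprB opprK addrC.
Qed.

Hypothesis pcN : forall i, piecewise_constant (N i).

Lemma consensus_nonincreasing_along w (f : R -> R) (s t : R) :
  0 <= s -> s <= t -> {within `[s, t], continuous f} ->
  (forall u, s < u < t -> (forall i, ~ switching_times (N i) u) ->
     exists2 df : R, is_derive u 1 f df & df <= 0) ->
  f t <= f s.
Proof.
move=> s0 st cf Df; have [E EN] := switching_times_seq s t pcN.
apply: (nonincreasing_off_finite (E := E) st cf) => u su uE.
exact/Df/EN.
Qed.

Lemma sum_in_le (S : {set 'I_n}) (F : 'I_n -> R) (c : R) :
  0 <= c -> (forall j, j \in S -> F j <= c) -> \sum_(j in S) F j <= n%:R * c.
Proof.
move=> c0 Fc; apply: (@le_trans _ _ (\sum_(j in S) c)); first exact: ler_sum.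
rewrite sumr_const mulr_natl ler_wpMn2l// -[leqRHS](card_ord n).
exact: max_card.
Qed.

Lemma consensus_le w (K s t : R) :
  0 <= A -> scalar_consensus N A alpha w -> 0 <= s -> s <= t ->
  (forall i, w i s <= K) -> forall i, w i t <= K.
Proof.
move=> A0 [cw [a [aA _ Dw]]] s0 st wK i; rewrite -subr_le0.
have [E EN] := switching_times_seq s t pcN.
apply: (quasipositive_barrier (E := E) (g := fun i t => w i t - K) A0 st) => //.
- move=> j x; apply: cvgB; last exact: cvg_cst.
  exact: (continuous_itvcy_sub s0 (cw j)).
- move=> u su uE j; have u0 : 0 < u by case/andP: su => /(le_lt_trans s0).
  exists (\sum_(k in N j u) a j k u * (w k u - w j u)).
    apply: (is_derive_eq (is_deriveB (Dw u u0 (EN u su uE) j) (is_derive_cst K u 1))).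
    by rewrite subr0.
  move=> wjK; rewrite mulr_sumr [leRHS](bigID (mem (N j u)))/= -[leLHS]addr0.
  apply: lerD; last by apply: sumr_ge0 => k _; rewrite mulr_ge0// le_max lexx orbT.
  apply: ler_sum => k _; have /andP[a0 aleA] := aA j k u (ltW u0).
  apply: (@le_trans _ _ (a j k u * Num.max (w k u - K) 0)).
    by rewrite ler_wpM2l// le_max; apply/orP; left; lra.
  by rewrite ler_wpM2r// le_max lexx orbT.
- by move=> j; rewrite subr_le0.
Qed.

(** A state below the common upper bound [M] stays below it by a fixed fraction of
the initial margin, over a time span [H]. *)
Lemma consensus_persist w (M d H s t : R) (i : 'I_n) :
  0 <= A -> scalar_consensus N A alpha w -> 0 <= s -> s <= t -> t <= s + H ->
  0 <= d -> (forall j, w j s <= M) -> w i s <= M - d ->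
  w i t <= M - expR (- (n%:R * A * H)) * d.
Proof.
move=> A0 Cw s0 st tH d0 wM wid.
have wMu u j : s <= u -> w j u <= M by move=> su; exact: consensus_le (wM) j.
move: Cw => [cw [a [aA _ Dw]]].
pose K := n%:R * A.
have K0 : 0 <= K by rewrite mulr_ge0.
have De (u : R) : is_derive u 1 (fun u => expR (K * u)) (expR (K * u) * K).
  have Dl : is_derive u 1 (fun u => K * u) K.
    apply: (is_derive_eq (is_derive_mulf (is_derive_cst _ _ _) (is_derive_id _ _))).
    by rewrite mulr1 mulr0 addr0.
  exact: is_derive1_comp.
(* [w i' <= K * (M - w i)] makes this function nonincreasing. *)
pose f u := expR (K * u) * (w i u - M).
have : f t <= f s.
  apply: consensus_nonincreasing_along => // [x|u /andP[su ut] Su].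
    apply: cvgM.
      apply: continuous_subspaceT => {}x.
      by apply: differentiable_continuous; apply/derivable1_diffP; case: (De x).
    apply: cvgB; last exact: cvg_cst.
    exact: (continuous_itvcy_sub s0 (cw i)).
  have u0 : 0 < u by exact: le_lt_trans su.
  pose dw := \sum_(k in N i u) a i k u * (w k u - w i u).
  have Dwi : is_derive u 1 (fun u => w i u - M) dw.
    apply: (is_derive_eq (is_deriveB (Dw u u0 Su i) (is_derive_cst M u 1))).
    by rewrite subr0.
  exists (expR (K * u) * dw + (w i u - M) * (expR (K * u) * K)).
    exact: is_derive_mulf.
  rewrite mulrCA -mulrDr pmulr_rle0 ?expR_gt0//.
  suff : dw <= n%:R * (A * (M - w i u)) by rewrite mulrA -/K; lra.
  apply: sum_in_le => [|k _]; first by rewrite mulr_ge0// subr_ge0 wMu// ltW.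
  have /andP[a0 aleA] := aA i k u (ltW u0).
  apply: (@le_trans _ _ (a i k u * (M - w i u))).
    by rewrite ler_wpM2l// lerB// wMu// ltW.
  by rewrite ler_wpM2r// subr_ge0 wMu// ltW.
rewrite /f => fts.
have : w i t - M <= - (expR (K * (s - t)) * d).
  rewrite mulrBr expRD expRN mulrAC -mulNr ler_pdivlMr ?expR_gt0//.
  rewrite mulrC (le_trans fts)// -mulrN ler_pM2l ?expR_gt0//; lra.
suff : expR (- (K * H)) * d <= expR (K * (s - t)) * d by rewrite -/K; lra.
by rewrite ler_wpM2r// ler_expR -mulrN ler_wpM2l//; lra.
Qed.

(** If [j] stays below [M] by [d1] and is a neighbor of [i] on an interval of
length [h], then [i] gets below [M] by [d2] at some time in that interval: as
long as it does not, it is attracted by [j] at rate at least [2 * q], against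
at most [q] from the other nodes. *)
Lemma consensus_pull w (M d1 d2 q h s : R) (i j : 'I_n) :
  0 <= A -> scalar_consensus N A alpha w -> 0 <= s -> 0 < h ->
  0 < d1 -> d2 <= d1 / 2 -> 0 <= d2 -> 2 * q <= alpha (d1 / 2) * (d1 / 2) ->
  0 <= alpha (d1 / 2) ->
  n%:R * A * d2 <= q -> d2 <= q * h ->
  (forall k, w k s <= M) ->
  (forall u, s <= u < s + h -> j \in N i u) ->
  (forall u, s <= u <= s + h -> w j u <= M - d1) ->
  exists2 u, s <= u <= s + h & w i u <= M - d2.
Proof.
move=> A0 Cw s0 h0 d10 d21 d20 q2 al0 qd qh wM ij wj.
have wMu u k : s <= u -> w k u <= M by move=> su; exact: consensus_le (wM) k.
apply: contrapT => no.
have wi u : s <= u -> u <= s + h -> M - d2 < w i u.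
  move=> su uh; rewrite ltNge; apply/negP => wiu.
  by apply: no; exists u; rewrite // su uh.
move: Cw => [cw [a [aA aal Dw]]].
have sh : s <= s + h by rewrite lerDl ltW.
suff : w i (s + h) + q * (s + h) <= w i s + q * s.
  by have := wi (s + h) sh (lexx _); have := wM i; lra.
apply: (@consensus_nonincreasing_along w (fun u => w i u + q * u)) => //.
  move=> x; apply: cvgD; first exact: (continuous_itvcy_sub s0 (cw i)).
  apply: continuous_subspaceT => {}x.
  by apply: cvgM; [exact: cvg_cst|exact: cvg_id].
move=> u /andP[su ush] Su.
have u0 : 0 < u by exact: le_lt_trans su.
have us := ltW su; have uh := ltW ush.
exists (\sum_(k in N i u) a i k u * (w k u - w i u) + q).
  apply: is_deriveD; first exact: Dw.
  apply: (is_derive_eq (is_derive_mulf (is_derive_cst _ _ _) (is_derive_id _ _))).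
  by rewrite mulr1 mulr0 addr0.
rewrite -lerBrDr sub0r (bigD1 j)/=; last by apply: ij; rewrite us.
have aj : a i j u * (w j u - w i u) <= - (2 * q).
  have wij : w j u - w i u <= - (d1 / 2).
    by have := wj u; rewrite us uh => /(_ isT); have := wi u us uh; lra.
  have aij : alpha (d1 / 2) <= a i j u.
    apply: aal; [exact: ltW|lra|].
    by rewrite distrC ger0_norm; lra.
  nra.
suff : \sum_(k in N i u | k != j) a i k u * (w k u - w i u) <= n%:R * (A * d2).
  by rewrite mulrA; lra.
rewrite (eq_bigl (mem (N i u :\ j))); last by move=> k; rewrite !inE andbC.
apply: sum_in_le => [|k _]; first exact: mulr_ge0.
have /andP[a0 aleA] := aA i k u (ltW u0).
apply: (@le_trans _ _ (a i k u * d2)); last by rewrite ler_wpM2r.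
by rewrite ler_wpM2l//; have := wMu u k us; have := wi u us uh; lra.
Qed.

End scalar_consensus_theory.

(** The nodes whose state is below [M] by at least [d] at time [t].  Nodes above a
lower bound [m] by [d] are obtained by applying this to the opposite states
and to [- m]. *)
Definition low_nodes (R : realType) (n : nat) (w : 'I_n -> R -> R) (M d t : R) :
  {set 'I_n} := [set i | w i t <= M - d].

Section contraction.
Context (R : realType) (n : nat) (N : 'I_n -> R -> {set 'I_n}).
Context (A : R) (alpha : R -> R) (h T : R).
Hypothesis pcN : forall i, piecewise_constant (N i).
Hypothesis A_ge0 : 0 <= A.
Hypothesis alpha_gt0 : forall e, 0 < e -> 0 < alpha e.
Hypothesis h_gt0 : 0 < h.
Hypothesis T_gt0 : 0 < T.
Hypothesis edge_interval : forall i t,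
  exists2 s, t - h <= s <= t & forall u, s <= u < s + h -> N i u = N i t.
Hypothesis rooted : forall t, quasi_strongly_connected (union_graph N t (t + T)).
Implicit Type w : 'I_n -> R -> R.

(* A connectivity window of length [T], padded by [h] on both sides to contain
   the intervals on which its edges are maintained. *)
Let H : R := T + 2 * h.
Let H_gt0 : 0 < H. Proof. by rewrite addr_gt0 ?mulr_gt0. Qed.

(* The fraction of a margin that persists over a padded window. *)
Let beta : R := expR (- (n%:R * A * H)).
Let beta_gt0 : 0 < beta. Proof. exact: expR_gt0. Qed.

Let beta_le1 : beta <= 1.
Proof. by rewrite -expR0 ler_expR oppr_le0 !mulr_ge0// ltW. Qed.

(* The net speed at which a node is pulled by a neighbor of margin [beta * d]. *)
Let rate (d : R) : R := alpha (beta * d / 2) * (beta * d / 2) / 2.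

Let rate_gt0 d : 0 < d -> 0 < rate d.
Proof.
move=> d0; rewrite /rate divr_gt0// mulr_gt0 ?alpha_gt0//;
  by rewrite divr_gt0// mulr_gt0.
Qed.

(* The margin that a node acquires when pulled; the three bounds are those
   required by [consensus_pull]. *)
Let pulled (d : R) : R :=
  Num.min (beta * d / 2) (Num.min (rate d / (n%:R * A + 1)) (rate d * h)).

Let pulled_gt0 d : 0 < d -> 0 < pulled d.
Proof.
move=> d0; have r0 := rate_gt0 d0.
rewrite /pulled !lt_min; apply/and3P; split.
- by rewrite divr_gt0// mulr_gt0.
- by rewrite divr_gt0// ltr_wpDl// mulr_ge0.
- exact: mulr_gt0.
Qed.

(* The margin left at the end of a padded window. *)
Let next (d : R) : R := beta * pulled d.

Let next_gt0 d : 0 < d -> 0 < next d.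
Proof. by move=> d0; rewrite mulr_gt0 ?pulled_gt0. Qed.

Lemma scalar_consensus_bounds w (m M s t : R) :
  scalar_consensus N A alpha w -> 0 <= s -> s <= t ->
  (forall i, m <= w i s <= M) -> forall i, m <= w i t <= M.
Proof.
move=> Cw s0 st wmM i; apply/andP; split.
  rewrite -lerN2; apply: (consensus_le pcN A_ge0 (scalar_consensusN Cw) s0 st).
  by move=> j; case/andP: (wmM j); rewrite lerN2.
apply: (consensus_le pcN A_ge0 Cw s0 st).
by move=> j; case/andP: (wmM j).
Qed.

Lemma scalar_consensus_spread w (e s t : R) :
  scalar_consensus N A alpha w -> 0 <= s -> s <= t ->
  (forall i j, `|w i s - w j s| <= e) -> forall i j, `|w i t - w j t| <= e.
Proof.
move=> Cw s0 st we i j.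
(* With [k] minimizing, all the states at time [s] lie between [w k s] and
   [w k s + e]. *)
have ne0 : [seq w k s | k <- enum 'I_n] != [::].
  by rewrite -size_eq0 size_map size_enum_ord; case: n i => [[]|].
have [_ /mapP[k _ ->] wk] := seq_extremum (@le_total _ _) le_trans ne0.
have wI l : w k s <= w l s <= w k s + e.
  rewrite wk; last by rewrite map_f// mem_enum.
  by have := we l k; rewrite ler_norml; lra.
have /andP[i1 i2] := scalar_consensus_bounds Cw s0 st wI i.
have /andP[j1 j2] := scalar_consensus_bounds Cw s0 st wI j.
by rewrite ler_norml; lra.
Qed.

Let low_persist w (M d t : R) :
  scalar_consensus N A alpha w -> 0 <= t -> 0 < d ->
  (forall i, w i t <= M) ->
  low_nodes w M d t \subset low_nodes w M (next d) (t + H).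
Proof.
move=> Cw t0 d0 wM; apply/fintype.subsetP => i; rewrite !inE => wi.
have : w i (t + H) <= M - beta * d.
  by apply: (consensus_persist pcN A_ge0 Cw t0) => //; rewrite ?lerDl ltW.
suff : next d <= beta * d by lra.
rewrite ler_pM2l// /pulled ge_min; apply/orP; left.
have := beta_le1; have := beta_gt0; nra.
Qed.

(* The window starts at [t + h], so that its edges are maintained after [t]. *)
Let low_grow w (M d t : R) (r : 'I_n) :
  scalar_consensus N A alpha w -> 0 <= t -> 0 < d ->
  (forall i, w i t <= M) ->
  (forall i, connect (union_graph N (t + h) (t + h + T)) i r) ->
  r \in low_nodes w M d t -> low_nodes w M d t != finset.setT ->
  low_nodes w M d t \proper low_nodes w M (next d) (t + H).
Proof.
move=> Cw t0 d0 wM root rlow; rewrite -finset.subTset => /fintype.subsetPn[x _ xlow].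
have [i [j [ilow jlow]]] := connect_crossing (root x) xlow rlow.
rewrite /union_graph /= => /asboolP[u [/andP[tu uT] ju]].
rewrite properE low_persist//=; apply/fintype.subsetPn; exists i => //.
have [s /andP[us su] Ns] := edge_interval i u.
have ts : t <= s by lra.
have s0 : 0 <= s by lra.
have wMs k v : t <= v -> w k v <= M.
  by move=> tv; exact: (consensus_le pcN A_ge0 Cw t0 tv wM).
have r0 := rate_gt0 d0.
have bd0 : 0 < beta * d by rewrite mulr_gt0.
have p0 := pulled_gt0 d0.
have [v /andP[sv vs] wiv] : exists2 v, s <= v <= s + h & w i v <= M - pulled d.
  apply: (@consensus_pull _ _ N A alpha pcN w M (beta * d) (pulled d) (rate d) h
    s i j) => //.
  - by rewrite /pulled ge_min lexx.
  - exact: ltW.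
  - by rewrite /rate; lra.
  - by rewrite ltW// alpha_gt0//; lra.
  - have K0 : 0 <= n%:R * A by rewrite mulr_ge0.
    have : pulled d <= rate d / (n%:R * A + 1) by rewrite /pulled !ge_min lexx orbT.
    by rewrite ler_pdivlMr; nra.
  - by rewrite /pulled !ge_min lexx !orbT.
  - by move=> k; exact: wMs.
  - by move=> v vI; rewrite Ns.
  - move=> v /andP[sv vs].
    apply: (consensus_persist pcN A_ge0 Cw t0) => //; rewrite /H; try lra.
    by move: jlow; rewrite inE.
rewrite inE.
apply: (consensus_persist pcN A_ge0 Cw (s := v)) => //; rewrite /H; try lra.
by move=> k; apply: wMs; lra.
Qed.

(** By induction on the number [k] of windows still available: each of them adds a
node to [lo] or to [hi], unless one of them is already everything.  Initially
the two cardinals add up to at least [n], so [k = n] windows suffice. *)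
Lemma low_high_contract (k : nat) (d : R) : 0 < d ->
  exists2 d' : R, 0 < d' & forall w (m M t : R),
    scalar_consensus N A alpha w -> 0 <= t ->
    (forall i, m <= w i t <= M) ->
    let lo := low_nodes w M d t in
    let hi := low_nodes (fun i t => - w i t) (- m) d t in
    lo :|: hi = finset.setT ->
    [\/ lo = finset.setT, hi = finset.setT | (2 * n <= #|lo| + #|hi| + k)%N] ->
    (forall i, w i (t + k%:R * H) <= M - d') \/
    (forall i, m + d' <= w i (t + k%:R * H)).
Proof.
elim: k d => [|k IHk] d d0.
  exists d => // w m M t Cw t0 wmM lo hi lohi full; rewrite mul0r addr0.
  have [loT|hiT] : lo = finset.setT \/ hi = finset.setT.
    case: full => [->|->|]; [by left|by right|rewrite addn0 mul2n -addnn => le2].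
    left; apply/eqP; rewrite eqEcard finset.subsetT finset.cardsT card_ord/=.
    rewrite -(leq_add2r n) (leq_trans le2)// leq_add2l -[leqRHS]card_ord.
    exact: max_card.
  - left => i; have : i \in lo by rewrite loT finset.in_setT.
    by rewrite inE.
  - right => i; have : i \in hi by rewrite hiT finset.in_setT.
    by rewrite inE; lra.
have [d' d'0 IH] := IHk _ (next_gt0 d0).
exists d' => // w m M t Cw t0 wmM lo hi lohi full.
have CNw := scalar_consensusN Cw.
have wM i : w i t <= M by case/andP: (wmM i).
have Nwm i : - w i t <= - m by case/andP: (wmM i) => mw _; rewrite lerN2.
have tH0 : 0 <= t + H by rewrite addr_ge0// ltW.
have losub : lo \subset low_nodes w M (next d) (t + H) by exact: low_persist.
have hisub : hi \subset low_nodes (fun i t => - w i t) (- m) (next d) (t + H).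
  exact: (low_persist CNw).
have -> : t + k.+1%:R * H = t + H + k%:R * H by rewrite -natr1; ring.
apply: (IH w m M (t + H)) => //.
- by apply: (scalar_consensus_bounds Cw t0 _ wmM); rewrite lerDl ltW.
- by apply/eqP; rewrite -finset.subTset -lohi finset.setUSS.
have TS (S S' : {set 'I_n}) : S = finset.setT -> S \subset S' -> S' = finset.setT.
  by move=> -> sub; apply/eqP; rewrite -finset.subTset.
have [loT|lonT] := eqVneq lo finset.setT.
  by apply: Or31; exact: TS loT losub.
have [hiT|hinT] := eqVneq hi finset.setT.
  by apply: Or32; exact: TS hiT hisub.
have {full} : (2 * n <= #|lo| + #|hi| + k.+1)%N.
  by case: full => [/eqP|/eqP|//]; [rewrite (negPf lonT)|rewrite (negPf hinT)].
rewrite addnS => full; apply: Or33; apply: (leq_trans full).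
have [r root] := rooted (t + h).
have /finset.setUP[rlo|rhi] : r \in lo :|: hi by rewrite lohi finset.in_setT.
- have := proper_card (low_grow Cw t0 d0 wM root rlo lonT).
  rewrite -addSn -addSn leq_add2r => lt.
  by apply: leq_add => //; exact: subset_leq_card.
- have := proper_card (low_grow CNw t0 d0 Nwm root rhi hinT).
  rewrite -addSn -addnS leq_add2r => lt.
  by apply: leq_add => //; exact: subset_leq_card.
Qed.

Lemma range_decrease (e : R) : 0 < e ->
  exists2 eta : R, 0 < eta & forall w (m M t : R),
    scalar_consensus N A alpha w -> 0 <= t ->
    (forall i, m <= w i t <= M) -> e <= M - m ->
    (forall i, w i (t + n%:R * H) <= M - eta) \/
    (forall i, m + eta <= w i (t + n%:R * H)).
Proof.
move=> e0; have e20 : 0 < e / 2 by lra.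
have [eta eta0 step] := low_high_contract n e20.
exists eta => // w m M t Cw t0 wmM eMm; apply: (step w m M t) => //.
  apply/finset.setP => i; rewrite !inE.
  have [//|mw] := leP (w i t) (M - e / 2); apply/orP; right; lra.
apply: Or33; rewrite mul2n -addnn leq_add2r -[leqLHS](card_ord n) -finset.cardsT.
rewrite (_ : finset.setT = low_nodes w M (e / 2) t :|:
  low_nodes (fun i t => - w i t) (- m) (e / 2) t) ?leq_card_setU//.
apply/esym/finset.setP => i; rewrite !inE.
have [//|mw] := leP (w i t) (M - e / 2); apply/orP; right; lra.
Qed.

(** The time [tau] is uniform in the trajectory and in its gains. *)
Lemma scalar_consensus_attractive (W e : R) : 0 <= W -> 0 < e ->
  exists2 tau : R, 0 < tau & forall w, scalar_consensus N A alpha w ->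
    (forall i, `|w i 0| <= W) -> forall i j, `|w i tau - w j tau| <= e.
Proof.
move=> W0 e0; have [eta eta0 step] := range_decrease e0.
have [r _] := rooted 0; have n0 : (0 < n)%N by exact: leq_ltn_trans (ltn_ord r).
have P0 : 0 < n%:R * H by rewrite mulr_gt0// ltr0n.
have iter w (k : nat) : scalar_consensus N A alpha w -> (forall i, `|w i 0| <= W) ->
    exists m M, (forall i, m <= w i (k%:R * (n%:R * H)) <= M) /\
      M - m <= Num.max e (2 * W - k%:R * eta).
  move=> Cw wW; elim: k => [|k [m [M [wmM Mm]]]].
    exists (- W), W; rewrite !mul0r; split=> [i|]; first by rewrite -ler_norml.
    by rewrite le_max; apply/orP; right; lra.
  have t0 : 0 <= k%:R * (n%:R * H) by rewrite mulr_ge0// ltW.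
  have kS : k.+1%:R * (n%:R * H) = k%:R * (n%:R * H) + n%:R * H.
    by rewrite -natr1; ring.
  have wmM' i : m <= w i (k.+1%:R * (n%:R * H)) <= M.
    by apply: (scalar_consensus_bounds Cw t0 _ wmM); rewrite kS lerDl ltW.
  have [Mme|eMm] := leP (M - m) e.
    by exists m, M; split=> //; rewrite le_max Mme.
  have {}Mm : M - m <= 2 * W - k%:R * eta.
    by move: Mm; rewrite le_max leNgt eMm.
  have [low|high] := step w m M _ Cw t0 wmM (ltW eMm).
    exists m, (M - eta); split=> [i|].
      by have /andP[-> _] := wmM' i; rewrite kS low.
    by rewrite le_max -natr1; apply/orP; right; lra.
  exists (m + eta), M; split=> [i|].
    by have /andP[_ ->] := wmM' i; rewrite kS high.
  by rewrite le_max -natr1; apply/orP; right; lra.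
pose k := (Num.truncn (2 * W / eta)).+1.
have kW : 2 * W <= k%:R * eta.
  by rewrite -ler_pdivrMr// ltW// truncnS_gt.
exists (k%:R * (n%:R * H)); first by rewrite mulr_gt0// ltr0n.
move=> w Cw wW i j; have [m [M [wmM Mm]]] := iter w k Cw wW.
have Mme : M - m <= e by move: Mm; rewrite le_max => /orP[//|]; lra.
have /andP[mi iM] := wmM i; have /andP[mj jM] := wmM j.
by rewrite ler_norml; apply/andP; split; lra.
Qed.

End contraction.

(** * Euclidean geometry of the sphere *)

(** The Euclidean inner product of column vectors. *)
Definition cdot (R : realType) (d : nat) (u v : 'cV[R]_d) : R :=
  \sum_k u k ord0 * v k ord0.

Section euclidean.
Context (R : realType) (d : nat).
Implicit Types u v w c y : 'cV[R]_d.

Lemma cdotC u v : cdot u v = cdot v u.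
Proof. by apply: eq_bigr => k _; rewrite mulrC. Qed.

Lemma cdotBl u v w : cdot (u - v) w = cdot u w - cdot v w.
Proof. by rewrite -sumrB; apply: eq_bigr => k _; rewrite !mxE mulrBl. Qed.

Lemma cdotBr u v w : cdot u (v - w) = cdot u v - cdot u w.
Proof. by rewrite cdotC cdotBl !(cdotC u). Qed.

Lemma cdotZl a u v : cdot (a *: u) v = a * cdot u v.
Proof. by rewrite mulr_sumr; apply: eq_bigr => k _; rewrite !mxE mulrA. Qed.

Lemma cdotZr a u v : cdot u (a *: v) = a * cdot u v.
Proof. by rewrite cdotC cdotZl cdotC. Qed.

Lemma cdotNr u v : cdot u (- v) = - cdot u v.
Proof. by rewrite -scaleN1r cdotZr mulN1r. Qed.

Lemma cdot_ge0 u : 0 <= cdot u u.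
Proof. by apply: sumr_ge0 => k _; rewrite -expr2 sqr_ge0. Qed.

Lemma mulmx_trmx_cdot u v : (u^T *m v) ord0 ord0 = cdot u v.
Proof. by rewrite mxE; apply: eq_bigr => k _; rewrite mxE. Qed.

Lemma enorm_ge0 m n (M : 'M[R]_(m, n)) : 0 <= enorm M.
Proof. exact: sqrtr_ge0. Qed.

Lemma enorm_sqr m n (M : 'M[R]_(m, n)) :
  enorm M ^+ 2 = \sum_i \sum_j M i j ^+ 2.
Proof.
rewrite sqr_sqrtr//; apply: sumr_ge0 => i _.
by apply: sumr_ge0 => j _; exact: sqr_ge0.
Qed.

Lemma enorm_cdot u : enorm u ^+ 2 = cdot u u.
Proof. by rewrite enorm_sqr; apply: eq_bigr => i _; rewrite big_ord1 expr2. Qed.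

Lemma entry_le_enorm m n (M : 'M[R]_(m, n)) i j : `|M i j| <= enorm M.
Proof.
rewrite -(@ler_pXn2r _ 2) ?nnegrE ?enorm_ge0// real_normK ?num_real// enorm_sqr.
rewrite (bigD1 i)//= (bigD1 j)//= -addrA lerDl addr_ge0 ?sumr_ge0// => k _;
  rewrite ?sqr_ge0// sumr_ge0// => l _; exact: sqr_ge0.
Qed.

Lemma enorm_le_entries m n (M : 'M[R]_(m, n)) (b : R) : 0 <= b ->
  (forall i j, `|M i j| <= b) -> enorm M <= (m * n)%:R * b.
Proof.
move=> b0 Mb.
rewrite -(@ler_pXn2r _ 2) ?nnegrE ?enorm_ge0 ?mulr_ge0// enorm_sqr.
apply: (@le_trans _ _ (\sum_(i < m) \sum_(j < n) b ^+ 2)).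
  apply: ler_sum => i _; apply: ler_sum => j _.
  by rewrite -real_normK ?num_real// ler_pXn2r ?nnegrE.
rewrite !sumr_const !card_ord -mulrnA [(n * m)%N]mulnC -[leLHS]mulr_natl exprMn.
rewrite ler_wpM2r ?sqr_ge0// -natrX ler_nat.
by case: (m * n)%N => // k; rewrite expnS leq_pmulr.
Qed.

Lemma sphere_cdot y : sphere y <-> cdot y y = 1.
Proof.
rewrite /sphere /= -enorm_cdot; split=> [->|]; first by rewrite expr1n.
by move/eqP; rewrite sqrp_eq1 ?enorm_ge0// => /eqP.
Qed.

Lemma cdot_sqr_le c u : cdot c c = 1 -> cdot c u ^+ 2 <= cdot u u.
Proof.
move=> cc; have := cdot_ge0 (u - cdot c u *: c).
by rewrite !(cdotBl, cdotBr, cdotZl, cdotZr) cc (cdotC u c) expr2; lra.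
Qed.

Lemma cdot_norm_le c u : cdot c c = 1 -> `|cdot c u| <= enorm u.
Proof.
move=> cc; rewrite -(@ler_pXn2r _ 2) ?nnegrE ?enorm_ge0// real_normK ?num_real//.
by rewrite enorm_cdot cdot_sqr_le.
Qed.

Lemma cdot_unit_norm_le1 u v : cdot u u = 1 -> cdot v v = 1 -> `|cdot u v| <= 1.
Proof.
move=> uu vv; rewrite (le_trans (cdot_norm_le v uu))//.
by move/sphere_cdot: vv => ->.
Qed.

Lemma cdot_unit_le1 u v : cdot u u = 1 -> cdot v v = 1 -> cdot u v <= 1.
Proof.
by move=> uu vv; apply: le_trans (cdot_unit_norm_le1 uu vv); exact: ler_norm.
Qed.

Lemma enorm_unit u : cdot u u = 1 -> enorm u = 1.
Proof. by move=> /sphere_cdot. Qed.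

Lemma enorm_sphereB u v : cdot u u = 1 -> cdot v v = 1 ->
  enorm (u - v) ^+ 2 = 2 - 2 * cdot u v.
Proof.
by move=> uu vv; rewrite enorm_cdot !(cdotBl, cdotBr) uu vv (cdotC v u); lra.
Qed.

Lemma enorm_sphereB_le2 u v : cdot u u = 1 -> cdot v v = 1 -> enorm (u - v) <= 2.
Proof.
move=> uu vv; rewrite -(@ler_pXn2r _ 2) ?nnegrE ?enorm_ge0// enorm_sphereB//.
have := cdot_unit_norm_le1 uu vv; rewrite ler_norml => /andP[l _].
by rewrite expr2; lra.
Qed.

Lemma sphere_ballE c (r : R) y : sphere c -> 0 < r ->
  sphere_ball c r y <-> cdot y y = 1 /\ 1 - r ^+ 2 / 2 <= cdot c y.
Proof.
move=> /sphere_cdot cc r0; rewrite /sphere_ball /=.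
have ballE : cdot y y = 1 -> (enorm (y - c) <= r) = (1 - r ^+ 2 / 2 <= cdot c y).
  move=> yy; rewrite -(@ler_pXn2r _ 2) ?nnegrE ?enorm_ge0 ?(ltW r0)//.
  by rewrite enorm_sphereB// (cdotC y c); apply/idP/idP; lra.
split=> [[/sphere_cdot yy]|[yy]]; first by rewrite ballE.
by rewrite -ballE//; split=> //; exact/sphere_cdot.
Qed.

Lemma orthogonal_unit_vector c : (2 <= d)%N ->
  exists y, cdot y y = 1 /\ cdot c y = 0.
Proof.
move=> d2; pose k0 := Ordinal (leq_trans (isT : (0 < 2)%N) d2).
pose k1 := Ordinal (leq_trans (isT : (1 < 2)%N) d2).
have k01 : k0 != k1 by [].
have cdot_delta u k : cdot u (delta_mx k ord0) = u k ord0.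
  rewrite /cdot (bigD1 k)//= !mxE !eqxx mulr1 big1 ?addr0// => l lk.
  by rewrite mxE (negPf lk) mulr0.
suff [u u0 cu] : exists2 u, cdot u u != 0 & cdot c u = 0.
  exists ((enorm u)^-1 *: u); rewrite !(cdotZl, cdotZr) cu mulr0; split=> //.
  have e0 : enorm u != 0 by rewrite -sqrf_eq0 enorm_cdot.
  by rewrite -enorm_cdot; field.
have [ck0|ck0] := eqVneq (c k0 ord0) 0.
  exists (delta_mx k0 ord0); first by rewrite cdot_delta mxE !eqxx oner_neq0.
  by rewrite cdot_delta.
exists (c k1 ord0 *: delta_mx k0 ord0 - c k0 ord0 *: delta_mx k1 ord0).
  rewrite !(cdotBr, cdotZr, cdot_delta) !mxE !eqxx (eq_sym k1 k0) (negPf k01) /=.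
  rewrite !mulr0 !mulr1 subr0 sub0r mulrN opprK gt_eqF//.
  by rewrite ltr_wpDl -?expr2 ?sqr_ge0// exprn_even_gt0.
by rewrite cdotBr !cdotZr !cdot_delta mulrC subrr.
Qed.

(** Otherwise the ball would contain a unit vector orthogonal to [c] together with
its opposite, which no open hemisphere does. *)
Lemma sphere_ball_in_hemisphere c v (r : R) : (2 <= d)%N -> sphere c -> 0 < r ->
  sphere_ball c r `<=` open_hemisphere v -> 0 < 1 - r ^+ 2 / 2.
Proof.
move=> d2 Sc r0 Bv; rewrite ltNge; apply/negP => k0.
have [y [yy cy]] := orthogonal_unit_vector c d2.
have [_ +] : open_hemisphere v y.
  by apply: Bv; apply/sphere_ballE => //; rewrite cy.
have [_ +] : open_hemisphere v (- y).
  apply: Bv; apply/sphere_ballE => //.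
  by rewrite !cdotNr (cdotC _ y) cdotNr cy opprK oppr0.
by rewrite !mulmx_trmx_cdot (cdotC (- y)) (cdotC y) cdotNr; lra.
Qed.

(** With [a] and [b] the heights of [u] and [v], the right-hand side is the distance
of their gnomonic projections. *)
Lemma gnomonic_nonexpansive u v (a b : R) : cdot u u = 1 -> cdot v v = 1 ->
  0 < a <= 1 -> 0 < b <= 1 ->
  enorm (u - v) <= enorm (a^-1 *: u - b^-1 *: v).
Proof.
move=> uu vv /andP[a0 a1] /andP[b0 b1].
rewrite -(@ler_pXn2r _ 2) ?nnegrE ?enorm_ge0// enorm_sphereB// enorm_cdot.
rewrite !(cdotBl, cdotBr, cdotZl, cdotZr) uu vv (cdotC v u) !mulr1.
set p := a^-1; set q := b^-1.
have p1 : 1 <= p by rewrite invf_ge1.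
have q1 : 1 <= q by rewrite invf_ge1.
set s := cdot u v; have s1 : s <= 1 by exact: cdot_unit_le1.
have pq1 : 0 <= p * q - 1 by rewrite subr_ge0 mulr_ege1.
have := mulr_ge0 pq1 (_ : 0 <= 1 - s); rewrite subr_ge0 => /(_ s1).
by have := sqr_ge0 (p - q); rewrite expr2; lra.
Qed.

Lemma gnomonic_lipschitz c u v (k : R) (i : 'I_d) :
  cdot c c = 1 -> cdot u u = 1 -> cdot v v = 1 -> 0 < k ->
  k <= cdot c u -> k <= cdot c v ->
  `|u i ord0 / cdot c u - v i ord0 / cdot c v| <= 2 / k ^+ 2 * enorm (u - v).
Proof.
move=> cc uu vv k0 ku kv.
have u0 : 0 < cdot c u by exact: lt_le_trans ku.
have v0 : 0 < cdot c v by exact: lt_le_trans kv.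
have -> : u i ord0 / cdot c u - v i ord0 / cdot c v =
    ((u - v) i ord0 * cdot c v - v i ord0 * cdot c (u - v)) / (cdot c u * cdot c v).
  by rewrite cdotBr !mxE; field; rewrite ?gt_eqF.
rewrite normrM normfV [`|cdot c u * _|]ger0_norm; last by rewrite mulr_ge0 ?ltW.
have e0 := enorm_ge0 (u - v).
have uv : k ^+ 2 <= cdot c u * cdot c v by rewrite expr2; nra.
have num : `|(u - v) i ord0 * cdot c v - v i ord0 * cdot c (u - v)| <=
    2 * enorm (u - v).
  rewrite (le_trans (ler_normB _ _))// mulr_natl mulr2n lerD// normrM.
    rewrite -[leRHS]mulr1 ler_pM ?entry_le_enorm//.
    exact: cdot_unit_norm_le1.
  rewrite -[leRHS]mul1r ler_pM ?cdot_norm_le//.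
  rewrite (le_trans (entry_le_enorm _ _ _))//.
  by rewrite enorm_unit.
rewrite ler_pdivrMr ?mulr_gt0// (le_trans num)//.
set P := cdot c u * cdot c v in uv *.
have -> : 2 / k ^+ 2 * enorm (u - v) * P = 2 * enorm (u - v) * (P / k ^+ 2) by ring.
by rewrite ler_peMr ?mulr_ge0// ler_pdivlMr ?exprn_gt0// mul1r.
Qed.

End euclidean.

Lemma vec_mx_continuous (R : realType) (m n : nat) :
  continuous (@vec_mx R m n).
Proof.
move=> u s /nbhs_ballP[e e0 es]; apply/nbhs_ballP; exists e => //= v [_ uv].
by apply: es; split=> // i j; rewrite !mxE; exact: uv.
Qed.

Lemma continuous_sum_entries (R : realType) (T : topologicalType) (n : nat)
    (h : 'I_n -> T -> R) :
  (forall i, continuous (h i)) -> continuous (fun x => \sum_i h i x).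
Proof. by move=> ch x; apply: cvg_sumf => i; exact: ch. Qed.

Lemma compact_cartesian_power_sphere_ball (R : realType) (d n : nat)
    (c : 'cV[R]_d) (r : R) : sphere c -> 0 < r ->
  compact (cartesian_power (n := n) (sphere_ball c r)).
Proof.
move=> Sc r0; set S := cartesian_power _.
pose K := [set v : 'rV[R]_(d * n) | S (vec_mx v)].
have -> : S = (@vec_mx R d n) @` K.
  apply/seteqP; split=> [X SX|_ [v Kv <-] //].
  by exists (mxvec X); rewrite /K /= mxvecK.
apply: continuous_compact.
  by apply: continuous_subspaceT; exact: vec_mx_continuous.
apply: bounded_closed_compact.
  exists 1; split; first exact: num_real.
  move=> b b1 v Kv; suff : mx_norm v <= b by [].
  rewrite mx_normrE (bigmax_le _ (ltW (lt_trans ltr01 b1)))//.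
  move=> [i j] _ /=; rewrite (ord1 i) -[v]vec_mxK.
  have [[k l] ->] : exists kl : 'I_d * 'I_n, j = mxvec_index kl.1 kl.2.
    by case/mxvec_indexP: j => k l; exists (k, l).
  rewrite mxvecE.
  have /(sphere_ballE _ Sc r0)[vv _] := Kv l.
  have := entry_le_enorm (col l (vec_mx v)) k ord0.
  rewrite mxE => /le_trans; apply; apply: ltW; apply: le_lt_trans b1.
  by rewrite enorm_unit.
have -> : K = \bigcap_(i in [set: 'I_n])
    ((fun v => cdot (col i (vec_mx v)) (col i (vec_mx v))) @^-1` [set 1] `&`
     (fun v => cdot c (col i (vec_mx v))) @^-1` [set x | 1 - r ^+ 2 / 2 <= x]).
  apply/seteqP; split=> v; first by move=> Kv i _; exact/(sphere_ballE _ Sc r0).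
  by move=> Kv i; apply/(sphere_ballE _ Sc r0); exact: Kv.
have centry i k : continuous (fun v : 'rV[R]_(d * n) => col i (vec_mx v) k ord0).
  move=> v; rewrite (_ : (fun v => _) =
      fun v : 'rV[R]_(d * n) => v ord0 (mxvec_index k i)).
    exact: coord_continuous.
  by apply/funext => u; rewrite !mxE.
apply: closed_bigI => i _; apply: closedI; apply: preimage_closed.
- move=> v _; apply: continuous_sum_entries => k {}v.
  exact: continuousM (centry i k v) (centry i k v).
- exact: closed_eq.
- move=> v _; apply: continuous_sum_entries => k {}v.
  exact: continuousM (@cst_continuous _ _ (c k ord0) v) (centry i k v).
- exact: closed_ge.
Qed.

(** * Solutions in projective coordinates *)

Lemma vector_field_entry (R : realType) (d n : nat) (f : 'I_n -> 'I_n -> R -> R)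
    (N : 'I_n -> R -> {set 'I_n}) (t : R) (X : 'M[R]_(d, n)) (i : 'I_n) (k : 'I_d) :
  cdot (col i X) (col i X) = 1 ->
  vector_field f N t X i k ord0 =
  \sum_(j in N i t) f i j (enorm (col j X - col i X)) *
    (X k j - cdot (col i X) (col j X) * X k i).
Proof.
move=> xx; rewrite /vector_field mulmx_sumr summxE; apply: eq_bigr => j _.
rewrite -scalemxAr mxE; congr (_ * _).
set u := col i X in xx *; set w := col j X.
rewrite mulmxBl mul1mx -mulmxA [u^T *m _]mx11_scalar mulmx_trmx_cdot.
by rewrite mul_mx_scalar cdotBr xx !mxE; ring.
Qed.

Lemma is_derive_entry (R : realType) (m n : nat) (F : R -> 'M[R]_(m, n)) (t : R)
    (dF : 'M[R]_(m, n)) (i : 'I_m) (j : 'I_n) :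
  is_derive t 1 F dF -> is_derive t 1 (fun s => F s i j) (dF i j).
Proof.
move=> [DF <-]; rewrite derive_mx// mxE.
by apply: derivableP; move: DF => /derivable_mxP.
Qed.

Section weights.
Context (R : realType) (n : nat) (f : 'I_n -> 'I_n -> R -> R).
Hypothesis wf : weights f.

Lemma weight_lipschitz i j : exists2 L : R, 0 <= L &
  forall y z, `|f i j y - f i j z| <= L * `|y - z|.
Proof.
have [[L [_ fL]] _] := wf i j.
exists (Num.max 0 L + 1); first by rewrite addr_ge0// le_max lexx.
have Lm : L < Num.max 0 L + 1.
  by rewrite (@le_lt_trans _ _ (Num.max 0 L)) ?ltrDl// le_max lexx orbT.
by move=> y z; exact: (fL _ Lm (y, z) (conj I I)).
Qed.

Lemma weight_continuous i j : continuous (f i j).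
Proof.
have [L L0 fL] := weight_lipschitz i j.
move=> y; apply/cvgrPdist_le => /= e e0; near=> z.
rewrite (le_trans (fL y z))// (@le_trans _ _ ((L + 1) * `|y - z|))//.
  by rewrite ler_wpM2r// lerDl.
rewrite -ler_pdivlMl ?ltr_wpDl//.
near: z; exists ((L + 1)^-1 * e) => [|z /ltW //].
by rewrite /= mulr_gt0// invr_gt0 ltr_wpDl.
Unshelve. all: by end_near. Qed.

(** At [0] this follows from positivity on positive arguments by Lipschitz
continuity. *)
Lemma weight_ge0 i j y : 0 <= y -> 0 <= f i j y.
Proof.
have [_ fpos] := wf i j.
rewrite le_eqVlt => /predU1P[<-|/fpos /ltW //].
rewrite leNgt; apply/negP => f0.
have [L L0 fL] := weight_lipschitz i j.
pose z := - f i j 0 / (L + 1).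
have L1 : 0 < L + 1 by rewrite ltr_wpDl.
have z0 : 0 < z by rewrite divr_gt0// oppr_gt0.
have zL : (L + 1) * z = - f i j 0 by rewrite mulrC divfK ?gt_eqF.
have fz : f i j z - f i j 0 <= L * z.
  by rewrite (le_trans (ler_norm _))// (le_trans (fL _ _))// subr0 gtr0_norm.
by have := fpos _ z0; lra.
Qed.

Lemma weights_bounded (b : R) : exists2 F : R, 0 <= F &
  forall i j y, 0 <= y <= b -> 0 <= f i j y <= F.
Proof.
have : \forall F \near +oo, forall ij : 'I_n * 'I_n, forall y, 0 <= y <= b ->
    f ij.1 ij.2 y <= F.
  apply: filter_forall => -[i j] /=.
  have [L L0 fL] := weight_lipschitz i j.
  near=> F => y /andP[y0 yb].
  apply: (@le_trans _ _ (f i j 0 + L * b)); last first.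
    by near: F; apply: nbhs_pinfty_ge; exact: num_real.
  rewrite -lerBlDl (le_trans (ler_norm _))// (le_trans (fL _ _))//.
  by rewrite ler_wpM2l// subr0 ger0_norm.
move=> /(filterI (nbhs_pinfty_ge (num_real 0)))/filter_ex[F [/= F0 fF]].
exists F => // i j y yb; rewrite (fF (i, j))// andbT.
by apply: weight_ge0; case/andP: yb.
Unshelve. all: by end_near. Qed.

Lemma weights_bounded_below (e b : R) : 0 < e -> exists2 p : R, 0 < p &
  forall i j y, e <= y <= b -> p <= f i j y.
Proof.
move=> e0; have [eb|be] := leP e b; last first.
  by exists 1 => // i j y /andP[ey yb]; have := lt_le_trans be ey; lra.
have : \forall p \near 0^'+, forall ij : 'I_n * 'I_n, forall y, e <= y <= b ->
    p <= f ij.1 ij.2 y.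
  apply: filter_forall => -[i j] /=.
  have [z zI fz] : exists2 z, z \in `[e, b]%R &
      forall y, y \in `[e, b]%R -> f i j z <= f i j y.
    by apply: EVT_min => //; apply: continuous_subspaceT; exact: weight_continuous.
  near=> p => y yI; apply: (@le_trans _ _ (f i j z)).
    near: p; apply: nbhs_right_le.
    have [_] := wf i j; apply.
    by move: zI; rewrite in_itv => /andP[ez _]; exact: lt_le_trans ez.
  by apply: fz; rewrite in_itv.
move=> /(filterI (nbhs_right_gt 0))/filter_ex[p [/= p0 fp]].
by exists p => // i j y; exact: fp (i, j) y.
Unshelve. all: by end_near. Qed.

End weights.

Section solution_theory.
Context (R : realType) (d n : nat).
Context (N : 'I_n -> R -> {set 'I_n}) (f : 'I_n -> 'I_n -> R -> R).
Context (X : R -> 'M[R]_(d, n)) (c : 'cV[R]_d).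
Hypothesis solX : solution f N X.

(* The height is the coordinate along the axis of the cap; the weight is that of
   [x j] in the equation of [x i]. *)
Let x i t : 'cV[R]_d := col i (X t).
Let height i t : R := cdot c (x i t).
Let weight i j t : R := f i j (enorm (x j t - x i t)).

Lemma solution_sphere i t : 0 <= t -> cdot (x i t) (x i t) = 1.
Proof. by move=> t0; apply/sphere_cdot; case: solX => [/(_ t t0 i)]. Qed.

Lemma solution_entry_continuous k i :
  {within `[0, +oo[, continuous (fun t => X t k i)}.
Proof.
case: solX => _ cX _ t.
exact: (continuous_comp (cX t) (@coord_continuous _ _ _ k i (X t))).
Qed.

Lemma solution_entry_derive k i t :
  0 < t -> (forall i, ~ switching_times (N i) t) ->
  is_derive t 1 (fun s => X s k i)
    (\sum_(j in N i t) weight i j t *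
      (X t k j - cdot (x i t) (x j t) * X t k i)).
Proof.
case: solX => _ _ DX t0 St; rewrite -vector_field_entry; last first.
  exact/solution_sphere/ltW.
have := is_derive_entry k ord0 (DX t t0 St i).
by congr is_derive; apply/funext => s; rewrite mxE.
Qed.

Lemma height_continuous i : {within `[0, +oo[, continuous (height i)}.
Proof.
have -> : height i = fun t => \sum_k c k ord0 * X t k i.
  by apply/funext => t; apply: eq_bigr => k _; rewrite mxE.
move=> t; apply: (@cvg_sumf R _ (nbhs (t : subspace `[0, +oo[)) _ d
  (fun k t => c k ord0 * X t k i)) => k.
by apply: cvgM; [exact: cvg_cst|exact: solution_entry_continuous].
Qed.

Lemma height_derive i t :
  0 < t -> (forall i, ~ switching_times (N i) t) ->
  is_derive t 1 (height i) (\sum_(j in N i t) weight i j t *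
    (height j t - cdot (x i t) (x j t) * height i t)).
Proof.
move=> t0 St.
have -> : height i = fun t => \sum_k c k ord0 * X t k i.
  by apply/funext => s; apply: eq_bigr => k _; rewrite mxE.
apply: (is_derive_eq (is_derive_sumf (fun k =>
  is_derive_mulf (is_derive_cst (c k ord0) t 1) (solution_entry_derive k i t0 St)))).
under eq_bigr do rewrite mulr0 addr0 mulr_sumr.
rewrite exchange_big /=; apply: eq_bigr => j _.
rewrite mulr_sumr -sumrB mulr_sumr; apply: eq_bigr => k _.
by rewrite !mxE; ring.
Qed.

Context (F : R) (kappa : R).
Hypothesis pcN : forall i, piecewise_constant (N i).
Hypothesis cc : cdot c c = 1.
Hypothesis kappa_gt0 : 0 < kappa.
Hypothesis F_ge0 : 0 <= F.
Hypothesis fF : forall i j y, 0 <= y <= 2 -> 0 <= f i j y <= F.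
Hypothesis X0 : forall i, kappa <= height i 0.

Let weightF i j t : 0 <= t -> 0 <= weight i j t <= F.
Proof.
by move=> t0; apply: fF; rewrite enorm_ge0 enorm_sphereB_le2// solution_sphere.
Qed.

(** The barrier principle applies to [kappa - height]. *)
Lemma cap_invariant i t : 0 <= t -> kappa <= height i t.
Proof.
move=> t0; rewrite -subr_le0.
have [E EN] := switching_times_seq 0 t pcN.
apply: (quasipositive_barrier (E := E) (g := fun i t => kappa - height i t)
  (C := F * (n%:R + 1)) _ t0).
- by rewrite mulr_ge0// addr_ge0.
- move=> j s; apply: cvgB; first exact: cvg_cst.
  exact: (continuous_itvcy_sub (lexx _) (@height_continuous j)).
- move=> s s0 sE j; have s_gt0 : 0 < s by case/andP: s0.
  pose p k := Num.max (kappa - height k s) 0.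
  have p0 k : 0 <= p k by rewrite le_max lexx orbT.
  have pge k : kappa - height k s <= p k by rewrite le_max lexx.
  exists (- \sum_(k in N j s) weight j k s *
      (height k s - cdot (x j s) (x k s) * height j s)).
    apply: (is_derive_eq (is_deriveB (is_derive_cst kappa s 1)
      (height_derive j s_gt0 (EN s s0 sE)))).
    by rewrite sub0r.
  have Sp : p j <= \sum_k p k by rewrite (bigD1 j)//= lerDl sumr_ge0.
  have SN : \sum_(k in N j s) p k <= \sum_k p k.
    by rewrite [leRHS](bigID (mem (N j s)))/= lerDl sumr_ge0.
  move=> /= gj; rewrite -sumrN.
  apply: (@le_trans _ _ (\sum_(k in N j s) F * (p k + p j))).
    apply: ler_sum => k _; have /andP[w0 wF] := weightF j k (ltW s_gt0).
    have [xj xk] := (solution_sphere j (ltW s_gt0), solution_sphere k (ltW s_gt0)).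
    have := cdot_unit_norm_le1 xj xk; rewrite ler_norml => /andP[c1 c2].
    rewrite -mulrN; apply: (@le_trans _ _ (weight j k s * (p k + p j))).
      apply: ler_wpM2l => //; rewrite opprB.
      have := pge k; have := pge j; have := p0 j; have := p0 k.
      have [h0|h0] := leP 0 (height j s).
        have : cdot (x j s) (x k s) * height j s <= height j s by rewrite ler_piMl.
        by lra.
      have : cdot (x j s) (x k s) * height j s <= - height j s.
        by rewrite -[leRHS]mul1r mulrN -mulNr ler_wnM2r// ltW.
      by have := kappa_gt0; lra.
    by rewrite ler_wpM2r// addr_ge0.
  rewrite -mulr_sumr -mulrA ler_wpM2l// big_split /= mulrDl mul1r addrC lerD//.
    rewrite sumr_const mulr_natl (@le_trans _ _ (p j *+ n))//.
      by rewrite ler_wpMn2l// -[leqRHS](card_ord n) max_card.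
    exact: ler_wMn2r.
- by move=> j; rewrite subr_le0.
Qed.

Let height_gt0 i t : 0 <= t -> 0 < height i t.
Proof. by move=> t0; apply: lt_le_trans kappa_gt0 _; exact: cap_invariant. Qed.

Let height_le1 i t : 0 <= t -> height i t <= 1.
Proof. by move=> t0; rewrite /height cdot_unit_le1// solution_sphere. Qed.

(** Each coordinate of the gnomonic projections solves a scalar consensus system
whose constants depend only on the bounds [F] and [phi] of the weights and on
the size of the cap. *)
Lemma projective_scalar_consensus (phi : R -> R) (k : 'I_d) :
  (forall e, 0 < e -> 0 < phi e) ->
  (forall e i j y, 0 < e -> e <= y <= 2 -> phi e <= f i j y) ->
  scalar_consensus N (F / kappa) (fun e => kappa * phi (e * kappa ^+ 2 / 2))
    (fun i t => X t k i / height i t).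
Proof.
move=> phi0 fphi; split.
  move=> i; apply/subspace_continuousP => t tI.
  have t0 : 0 <= t by move: tI; rewrite /= in_itv /= andbT.
  apply: cvgM.
    by have /subspace_continuousP := @solution_entry_continuous k i; apply.
  apply: cvgV; first by rewrite gt_eqF// height_gt0.
  by have /subspace_continuousP := @height_continuous i; apply.
exists (fun i j t => weight i j t * (height j t / height i t)); split.
- move=> i j t t0; have /andP[w0 wF] := weightF i j t0.
  have [yi yj] := (height_gt0 i t0, height_gt0 j t0).
  rewrite mulr_ge0 ?divr_ge0 ?(ltW yi) ?(ltW yj)//= ler_pM//.
    by rewrite divr_ge0 ?(ltW yi) ?(ltW yj).
  rewrite ler_pdivrMr// (le_trans (height_le1 j t0))//.
  by rewrite ler_pdivlMl// mulr1 cap_invariant.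
- move=> i j t e t0 e0 ew.
  have [yi yj] := (height_gt0 i t0, height_gt0 j t0).
  have [xi xj] := (solution_sphere i t0, solution_sphere j t0).
  have := gnomonic_lipschitz k cc xj xi kappa_gt0
    (cap_invariant j t0) (cap_invariant i t0).
  rewrite !mxE => /(le_trans ew) elip.
  have ek : e * kappa ^+ 2 / 2 <= enorm (x j t - x i t).
    rewrite ler_pdivrMr// -ler_pdivlMr ?exprn_gt0//.
    by rewrite (le_trans elip)// mulrC; lra.
  have ek0 : 0 < e * kappa ^+ 2 / 2 by rewrite divr_gt0// mulr_gt0// exprn_gt0.
  rewrite mulrC; apply: ler_pM.
  + exact/ltW/phi0.
  + exact: ltW.
  + apply: fphi => //.
    by rewrite ek enorm_sphereB_le2.
  + rewrite ler_pdivlMr// (le_trans _ (cap_invariant j t0))//.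
    by rewrite ler_piMr ?height_le1// ltW.
- move=> t t0 St i; have t0' := ltW t0.
  have yi0 : height i t != 0 by rewrite gt_eqF// height_gt0.
  have DV := is_deriveV yi0 (height_derive i t0 St).
  apply: (is_derive_eq (is_derive_mulf (solution_entry_derive k i t0 St) DV)).
  rewrite /GRing.scale /= mulrA !mulr_sumr -big_split /=; apply: eq_bigr => j _.
  by field; rewrite yi0 gt_eqF// height_gt0.
Qed.

End solution_theory.

(** * Distance to the consensus set *)

Section distance_to_consensus.
Context (R : realType) (d n : nat).
Implicit Types X Y : 'M[R]_(d, n).

Lemma dist_le_enorm (A : set 'M[R]_(d, n)) X Y :
  A Y -> Defs.dist X A <= enorm (Y - X).
Proof.
move=> AY; apply: ge_inf; last by exists Y.
by exists 0 => _ [Z _ <-]; exact: enorm_ge0.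
Qed.

Lemma dist_lt_enorm (A : set 'M[R]_(d, n)) X (e : R) :
  A !=set0 -> Defs.dist X A < e -> exists2 Y, A Y & enorm (Y - X) < e.
Proof.
move=> [Z AZ] /inf_lt[|_ [Y AY <-]]; first by exists (enorm (Z - X)), Z.
by exists Y.
Qed.

Lemma consensus_entries_close X (e : R) : @consensus R d n !=set0 ->
  Defs.dist X (@consensus R d n) < e ->
  forall k i j, `|X k i - X k j| <= 2 * e.
Proof.
move=> C0 /(dist_lt_enorm C0)[Y [_ Yeq] Ye] k i j.
have Yk : Y k i = Y k j by have /colP/(_ k) := Yeq i j; rewrite !mxE.
have := entry_le_enorm (Y - X) k i; have := entry_le_enorm (Y - X) k j.
rewrite !mxE Yk !ler_norml => /andP[a1 a2] /andP[b1 b2].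
by apply/andP; split; lra.
Qed.

Lemma dist_consensus_le X (e : R) : (0 < n)%N -> 0 <= e ->
  (forall i, cdot (col i X) (col i X) = 1) ->
  (forall i j, enorm (col i X - col j X) <= e) ->
  Defs.dist X (@consensus R d n) <= (d * n)%:R * e.
Proof.
move=> n0 e0 XS Xe; pose i0 := Ordinal n0.
pose Y : 'M[R]_(d, n) := \matrix_(k, j) X k i0.
have Yc j : col j Y = col i0 X by apply/colP => k; rewrite !mxE.
have CY : @consensus R d n Y.
  by split=> [j|i j]; rewrite !Yc//; apply/sphere_cdot.
rewrite (le_trans (dist_le_enorm X CY))//; apply: enorm_le_entries => // k j.
apply: le_trans (Xe i0 j); apply: le_trans (entry_le_enorm _ k ord0).
by rewrite !mxE.
Qed.

End distance_to_consensus.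

(** * Stability of the consensus set *)

Theorem proposition6 (R : realType) (d n : nat)
  (N : 'I_n -> R -> {set 'I_n}) (f : 'I_n -> 'I_n -> R -> R)
  (c : 'cV[R]_d) (r : R) (v : 'cV[R]_d) :
  (2 <= d)%N ->
  neighborhoods N ->
  uniformly_quasi_strongly_connected N ->
  weights f ->
  sphere c -> 0 < r ->
  sphere v -> sphere_ball c r `<=` open_hemisphere v ->
  guas_relative (solution f N) (@consensus R d n)
    (cartesian_power (sphere_ball c r)).
Proof.
move=> d2 [pcN rcN dwN] [T T0 rooted] wf Sc r0 _ Bv.
have cc : cdot c c = 1 by exact/sphere_cdot.
pose kappa : R := 1 - r ^+ 2 / 2.
have kappa0 : 0 < kappa by exact: sphere_ball_in_hemisphere Bv.
have [F F0 fF] := weights_bounded wf 2.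
have /choice[phi phiP] : forall e : R, exists p : R, 0 < e -> 0 < p /\
    forall i j (y : R), e <= y <= 2 -> p <= f i j y.
  move=> e; have [e0|_] := ltP 0 e; last by exists 0.
  by have [p p0 fp] := weights_bounded_below wf 2 e0; exists p.
have phi0 (e : R) : 0 < e -> 0 < phi e by move=> /phiP[].
have fphi (e : R) i j (y : R) : 0 < e -> e <= y <= 2 -> phi e <= f i j y.
  by move=> /phiP[_]; exact.
have [tauD tau0 gap] := dwell_time_gap dwN.
pose h := tauD / 2.
have h0 : 0 < h by rewrite divr_gt0.
have htau : 2 * h <= tauD by rewrite /h mulrC divfK.
have edge i (t : R) : exists2 s, t - h <= s <= t &
    forall u, s <= u < s + h -> N i u = N i t.
  exact: (dwell_interval (pcN i) (rcN i) (gap i) h0 htau).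
have [i0 _] := rooted 0.
have n0 : (0 < n)%N by exact: leq_ltn_trans (ltn_ord i0).
have d0 : (0 < d)%N by exact: leq_trans d2.
pose A := F / kappa.
have A0 : 0 <= A by rewrite divr_ge0 // ltW.
pose alpha (e : R) := kappa * phi (e * kappa ^+ 2 / 2).
have alpha0 (e : R) : 0 < e -> 0 < alpha e.
  move=> e0; rewrite mulr_gt0// phi0// divr_gt0// mulr_gt0// exprn_gt0//.
pose S : set 'M[R]_(d, n) := cartesian_power (sphere_ball c r).
pose w (X : R -> 'M[R]_(d, n)) k i t := X t k i / cdot c (col i (X t)).
have X0 (X : R -> 'M[R]_(d, n)) : S (X 0) -> forall i, kappa <= cdot c (col i (X 0)).
  by move=> SX i; have /(sphere_ballE _ Sc r0)[] := SX i.
have inv X (t : R) i : solution f N X -> S (X 0) -> 0 <= t ->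
    kappa <= cdot c (col i (X t)).
  by move=> sX SX t0; exact: (cap_invariant sX pcN kappa0 F0 fF (X0 X SX)).
have Cw X k : solution f N X -> S (X 0) -> scalar_consensus N A alpha (w X k).
  move=> sX SX.
  exact: (projective_scalar_consensus sX pcN cc kappa0 F0 fF (X0 X SX) k phi0 fphi).
(* Closeness of the projective coordinates gives closeness to consensus; the two
   factors of [C] come from bounding Euclidean norms by entries. *)
pose C : R := (d * n)%:R * (d * 1)%:R.
have C0 : 0 < C by rewrite /C -natrM ltr0n !muln_gt0 d0 n0.
have close X (t e : R) : solution f N X -> S (X 0) -> 0 <= t -> 0 <= e ->
    (forall k i j, `|w X k i t - w X k j t| <= e / C) ->
    Defs.dist (X t) (@consensus R d n) <= e.
  move=> sX SX t0 e0 we.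
  have eC0 : 0 <= e / C by rewrite divr_ge0// ltW.
  have sph i := solution_sphere sX i t0.
  have -> : e = (d * n)%:R * ((d * 1)%:R * (e / C)).
    by rewrite mulrA -/C mulrC divfK// gt_eqF.
  apply: dist_consensus_le => // [|i j]; first by rewrite mulr_ge0.
  have hI i' : 0 < cdot c (col i' (X t)) <= 1.
    by rewrite (lt_le_trans kappa0) ?inv//= cdot_unit_le1.
  apply: le_trans (gnomonic_nonexpansive (sph i) (sph j) (hI i) (hI j)) _.
  apply: enorm_le_entries => // k l.
  by rewrite (ord1 l) !mxE mulrC [X in _ - X]mulrC; exact: we.
split.
- by move=> X SX i; have [] := SX i.
- exact: compact_cartesian_power_sphere_ball.
- move=> X sX SX t t0 i; apply/(sphere_ballE _ Sc r0).
  by split; [exact: (solution_sphere sX)|exact: inv].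
- move=> e e0; have eC0 : 0 < e / C by rewrite divr_gt0.
  have k0 : 0 <= kappa^-1 by rewrite invr_ge0 ltW.
  have [tau tau_gt0 att] :=
    scalar_consensus_attractive pcN A0 alpha0 h0 T0 edge rooted k0 eC0.
  exists tau => // X sX SX; apply: close => //; try exact: ltW.
  move=> k i j; apply: att => [|l]; first exact: Cw.
  have sph := solution_sphere sX l (lexx 0).
  rewrite /w normrM normfV -[leRHS]mul1r ler_pM//.
  + have := entry_le_enorm (col l (X 0)) k ord0.
    by rewrite mxE (enorm_unit sph).
  + have yl := X0 X SX l; have y0 := lt_le_trans kappa0 yl.
    by rewrite gtr0_norm// lef_pV2.
- move=> e e0; have eC0 : 0 < e / C by rewrite divr_gt0.
  (* [D] turns the distance to the consensus set into a bound on the differences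
     of projective coordinates: the Lipschitz constant of the projection, a factor
     for bounding a norm by entries, and [4] because two entries are compared
     through a consensus state at distance less than [2 * delta],
     where [delta = e / C / D]. *)
  pose D : R := 2 / kappa ^+ 2 * (d * 1)%:R * 4.
  have D0 : 0 < D by rewrite /D !mulr_gt0 ?invr_gt0 ?exprn_gt0 ?ltr0n ?muln1.
  exists (e / C / D) => [|X sX SX Xd t t0]; first by rewrite divr_gt0.
  apply: close => //; first exact: ltW.
  move=> k; apply: (scalar_consensus_spread pcN A0 (Cw X k sX SX) (lexx 0) t0) => i j.
  have sph i' := solution_sphere sX i' (lexx 0).
  have := gnomonic_lipschitz k cc (sph i) (sph j) kappa0 (X0 X SX i) (X0 X SX j).
  rewrite !mxE => /le_trans; apply.
  have eCD0 : 0 < e / C / D by rewrite divr_gt0.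
  have ne : @consensus R d n !=set0.
    exists (\matrix_(l, _) c l ord0).
    have cE j' : col j' (\matrix_(l < d, _ < n) c l ord0) = c.
      by apply/colP => l; rewrite !mxE.
    by split=> [l|l m]; rewrite !cE.
  have Xd2 : Defs.dist (X 0) (@consensus R d n) < 2 * (e / C / D) by lra.
  have Xe : enorm (col i (X 0) - col j (X 0)) <= (d * 1)%:R * (2 * (2 * (e / C / D))).
    apply: enorm_le_entries => [|k' l]; first by lra.
    by rewrite !mxE; exact: consensus_entries_close.
  apply: le_trans (ler_wpM2l _ Xe) _; first by rewrite divr_ge0// sqr_ge0.
  have -> : 2 / kappa ^+ 2 * ((d * 1)%:R * (2 * (2 * (e / C / D)))) = D * (e / C / D).
    by rewrite /D; ring.
  by rewrite mulrC divfK// gt_eqF.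
Qed.
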